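(* Let $\mathcal M=\mathbb C$ and $\mathcal N=\mathbb B(\ell_2)$ with their natural traces. For $n\geq1$ let $T_n=e_{1,1}+\frac1{\sqrt n}(e_{1,n}+e_{n,1})+\frac1n e_{n,n}\geq0$ and let $S=(S_n)_{n\geq1}$ be defined by $S_n:\mathbb C\to\mathbb B(\ell_2)$, $S_n(\lambda)=\lambda T_n$. Then for every $\theta\in(1/2,1)$, $S$ is not of strong $\theta$-asymmetric type $(2\theta,2\theta)$.
   Context: $(e_{i,j})_{i,j\geq1}$ are the matrix units of $\mathbb B(\ell_2)$, and $L_p(\mathbb B(\ell_2))=S_p$ is the Schatten class. For $0<p\leq\infty$ and $0<\gamma<1$, $L_p(\mathcal N;\ell_\infty^\gamma)$ is the space of sequences $x=(x_n)$ for which there exist $a,b\in L_p(\mathcal N)^+$ and contractions $u_n\in\mathcal N$ with $x_n=a^\gamma u_nb^{1-\gamma}$ for all $n$; its quasi-norm is $\inf\|a\|_p^{\gamma}\|b\|_p^{1-\gamma}$ over all such decompositions. A sequence of maps $S=(S_n)$ is of strong $\gamma$-asymmetric type $(p,p)$ if $x\mapsto(S_n(x))_n$ is bounded from $L_p(\mathcal M)$ to $L_p(\mathcal N;\ell_\infty^\gamma)$. *)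

(* Defs.v *)
From HB Require Import structures.
From mathcomp Require Import all_boot all_order all_algebra.
From mathcomp Require Import all_classical all_reals all_analysis.
From mathcomp Require Import complex.
From mathcomp Require Import ring.

Set Implicit Arguments.
Unset Strict Implicit.
Unset Printing Implicit Defensive.

Import Order.TTheory GRing.Theory Num.Theory.
Import numFieldNormedType.Exports.

Local Open Scope classical_set_scope.
Local Open Scope ring_scope.
Local Open Scope complex_scope.

Section Ell2.
Context {R : realType}.
Implicit Types x y : nat -> R[i].

Definition sqnormc (z : R[i]) : R := complex.Re z ^+ 2 + complex.Im z ^+ 2.

Definition square_summable : {pred (nat -> R[i])} :=
  [pred x | (\sum_(0 <= k <oo) (sqnormc (x k))%:E < +oo)%E].

Lemma sqnormc_ge0 z : 0 <= sqnormc z.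
Proof. by rewrite addr_ge0 ?sqr_ge0. Qed.

Lemma sqnormcM (a z : R[i]) : sqnormc (a * z) = sqnormc a * sqnormc z.
Proof. case: a z => [a b] [c d]; rewrite /sqnormc /=; ring. Qed.

Lemma sqnormcD (z w : R[i]) : sqnormc (z + w) <= 2 * (sqnormc z + sqnormc w).
Proof.
case: z w => [a b] [c d]; rewrite /sqnormc /= -subr_ge0.
have -> : 2 * (a ^+ 2 + b ^+ 2 + (c ^+ 2 + d ^+ 2))
    - ((a + c) ^+ 2 + (b + d) ^+ 2) = (a - c) ^+ 2 + (b - d) ^+ 2 by ring.
by rewrite addr_ge0 ?sqr_ge0.
Qed.

Lemma square_summable_submod : submod_closed square_summable.
Proof.
have ge0 (x : nat -> R[i]) k : (0 <= (sqnormc (x k))%:E)%E.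
  by rewrite lee_fin sqnormc_ge0.
split=> [|a x y]; rewrite !inE.
  by rewrite eseries0 ?ltry// => k _ _; rewrite /sqnormc /= !expr0n addr0.
move=> x2 y2.
apply: (@le_lt_trans _ _ (\sum_(0 <= k <oo)
   ((2 * sqnormc a)%:E * (sqnormc (x k))%:E + 2%:E * (sqnormc (y k))%:E))%E).
  apply: lee_nneseries => [k _ _|k _]; first exact: ge0.
  rewrite -!EFinM -EFinD lee_fin.
  by rewrite (le_trans (sqnormcD _ _))// mulrDr sqnormcM mulrA.
have a2 : 0 <= 2 * sqnormc a by rewrite mulr_ge0 ?sqnormc_ge0.
rewrite nneseriesD; first last.
- by move=> k _ _; rewrite mule_ge0// lee_fin.
- by move=> k _ _; rewrite mule_ge0// lee_fin.
rewrite !nneseriesZl; first last.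
- by move=> k _; exact: ge0.
- by move=> k _; exact: ge0.
by rewrite lte_add_pinfty// lte_mul_pinfty// lee_fin.
Qed.

HB.instance Definition _ :=
  GRing.isSubmodClosed.Build R[i] (nat -> R[i]) square_summable
    square_summable_submod.

End Ell2.

Record ell2 (R : realType) :=
  Ell2 { ell2_val :> nat -> R[i]; ell2_valP : ell2_val \in square_summable }.

HB.instance Definition _ (R : realType) := [isSub for @ell2_val R].
HB.instance Definition _ (R : realType) := [Choice of ell2 R by <:].
HB.instance Definition _ (R : realType) :=
  [SubChoice_isSubLmodule of ell2 R by <:].

Section Hilbert.
Context {R : realType}.

(* Linear in the first variable; the complex series is summed componentwise. *)
Definition inner (x y : ell2 R) : R[i] :=
  limn (series (fun k => complex.Re (x k * (y k)^*)))
  +i* limn (series (fun k => complex.Im (x k * (y k)^*))).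

Definition norm2 (x : ell2 R) : R := Num.sqrt (complex.Re (inner x x)).

Lemma basis_subproof (i : nat) :
  (fun k => (k == i)%:R : R[i]) \in square_summable.
Proof.
rewrite inE (@nneseriesD1 _ _ i xpredT)//; last first.
  by move=> k _; rewrite lee_fin sqnormc_ge0.
rewrite eseries0 ?adde0 ?ltry// => k _ /= /negPf ->.
by rewrite /sqnormc /= expr0n addr0.
Qed.

Definition basis (i : nat) : ell2 R := Ell2 (basis_subproof i).

End Hilbert.

Notation op R := (ell2 R -> ell2 R).

Section Operators.
Context {R : realType}.
Implicit Types a b x y : op R.

(* Membership in B(ell_2). *)
Definition bounded_op a : Prop :=
  linear a /\ exists M : R, forall v, norm2 (a v) <= M * norm2 v.

Definition opnorm a : R :=
  sup [set norm2 (a v) | v in [set v | norm2 v <= 1]].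

Definition contraction a : Prop := bounded_op a /\ opnorm a <= 1.

Definition adjoint a : op R :=
  xget (fun=> 0) [set b | forall v w, inner (a v) w = inner v (b w)].

(* The order of [R[i]] is the partial one: [0 <= z] says that [z] is real and
   nonnegative. *)
Definition positive_op a : Prop :=
  bounded_op a /\ forall v, 0 <= inner (a v) v.

Definition poly_op (p : {poly R}) a : op R :=
  fun v => \sum_(i < size p) (p`_i)%:C *: iter i a v.

(* Continuous functional calculus of a positive operator [a], for [f]
   continuous on [[0, |a|]], an interval containing the spectrum of [a]:
   [f(a)] is the norm limit of [p(a)] as the polynomials [p] converge to [f]
   uniformly on that interval. *)
Definition is_fcalc (f : R -> R) a b : Prop :=
  bounded_op b /\
  forall e : R, 0 < e -> exists p : {poly R},
    (forall t : R, 0 <= t <= opnorm a -> `|p.[t] - f t| <= e) /\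
    opnorm (poly_op p a - b) <= e.

Definition fcalc (f : R -> R) a : op R := xget (fun=> 0) [set b | is_fcalc f a b].

(* [a^s] for [a] positive and [s > 0]. *)
Definition op_pow a (s : R) : op R := fcalc (fun t => t `^ s) a.

(* The natural trace, on positive operators. *)
Definition trace a : \bar R :=
  (\sum_(0 <= k <oo) (complex.Re (inner (a (basis k)) (basis k)))%:E)%E.

(* [|x|^p = (x^* x)^(p/2)] *)
Definition modulus_pow x (p : R) : op R := op_pow (adjoint x \o x) (p / 2).

(* [L_p(B(ell_2)) = S_p] for [0 < p < oo]. *)
Definition Lp (p : R) : set (op R) :=
  [set x | bounded_op x /\ (trace (modulus_pow x p) < +oo)%E].

Definition Lp_norm (p : R) x : R := fine (trace (modulus_pow x p)) `^ p^-1.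

Definition Lp_pos (p : R) : set (op R) := [set a | Lp p a /\ positive_op a].

Definition asym_decomposition (p gamma : R) (x : nat -> op R) a b : Prop :=
  [/\ Lp_pos p a, Lp_pos p b &
      exists u : nat -> op R,
        (forall n, contraction (u n)) /\
        (forall n, x n = op_pow a gamma \o u n \o op_pow b (1 - gamma))].

Definition Lp_asym (p gamma : R) : set (nat -> op R) :=
  [set x | exists a b, asym_decomposition p gamma x a b].

Definition Lp_asym_norm (p gamma : R) (x : nat -> op R) : R :=
  inf [set r | exists a b, asym_decomposition p gamma x a b /\
         r = Lp_norm p a `^ gamma * Lp_norm p b `^ (1 - gamma)].

(* [L_p] norm on the algebra of complex numbers, whose trace is the identity. *)
Definition LpC_norm (p : R) (z : R[i]) : R :=
  (complex.Re `|z| `^ p) `^ p^-1.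

Definition strong_asym_type (gamma p : R) (S : nat -> R[i] -> op R) : Prop :=
  exists C : R, forall z : R[i],
    Lp_asym p gamma (fun n => S n z) /\
    Lp_asym_norm p gamma (fun n => S n z) <= C * LpC_norm p z.

(* [basis], and hence the matrix units, are indexed from 0: [munit i j] is
   e_{i+1,j+1}. *)
Definition munit (i j : nat) : op R := fun v => v j *: basis i.

(* [Tmap k] and [Smap k] are T_n and S_n for [n = k + 1]. *)
Definition Tmap (k : nat) : op R := fun v =>
  munit 0 0 v
  + ((Num.sqrt k.+1%:R)^-1)%:C *: (munit 0 k v + munit k 0 v)
  + (k.+1%:R^-1)%:C *: munit k k v.

Definition Smap (k : nat) (z : R[i]) : op R := fun v => z *: Tmap k v.

End Operators.

(* Main.v *)
Require Import Defs.
From HB Require Import structures.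
From mathcomp Require Import all_boot all_order all_algebra.
From mathcomp Require Import all_classical all_reals all_analysis.
From mathcomp Require Import complex.
From mathcomp Require Import ring lra.

(* Suppose T_n = a^theta u_n b^(1-theta) with a, b in L_(2 theta)^+ and
   contractions u_n. Then
     n^(-1/2) = <T_n e_1, e_n> = <u_n b^(1-theta) e_1, a^theta e_n>
             <= |b^(1-theta) e_1| |a^theta e_n|    (n > 1),
   whereas the sum of |a^theta e_n|^2 is the trace of a^(2 theta), which is
   finite: this contradicts the divergence of the harmonic series.

   Since [Lp] is phrased with |a|^(2 theta) = (a^* a)^theta, one needs
   (a^2)^theta = (a^theta)^2, hence |p(a)| <= sup |p| on [0, |a|] for real
   polynomials p. This follows from p(a) >= 0 for p > 0 on [0, |a|], which is
   proved by factoring p: its real roots lie outside [0, |a|] and its other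
   roots come in conjugate pairs. *)

Set Implicit Arguments.
Unset Strict Implicit.
Unset Printing Implicit Defensive.

Import Order.TTheory GRing.Theory Num.Theory.
Import numFieldNormedType.Exports.
Local Open Scope ring_scope.
Local Open Scope complex_scope.

(** * Real inner product structure of $\ell_2$ *)

Section InnerProduct.
Context {R : realType}.
Implicit Types (x y z v w : ell2 R) (c : R).

(** The real part keeps all estimates in the ordered field [R]; [innerE] recovers the imaginary
    part. *)
Definition rinner x y : R := complex.Re (inner x y).

Lemma ell2D x y k : (x + y) k = x k + y k. Proof. by []. Qed.

Lemma ell2Z (a : R[i]) x k : (a *: x) k = a * x k. Proof. by []. Qed.

Lemma ell2P x y : (forall k, x k = y k) -> x = y.
Proof. by move=> xy; apply/val_inj/funext. Qed.

(** Bridge from the extended-real sums of the definitions to real series, whose limits are additive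
    and homogeneous. *)
Lemma eseries_fin_cvg (u : nat -> R) : (forall k, 0 <= u k) ->
  (\sum_(0 <= k <oo) (u k)%:E < +oo)%E ->
  cvgn (series u) /\ (\sum_(0 <= k <oo) (u k)%:E)%E = (limn (series u))%:E.
Proof.
move=> u0 uoo.
have cu : cvgn (series u).
  apply: nondecreasing_is_cvgn.
    by apply/nondecreasing_seqP => n; rewrite /series /= big_nat_recr //= lerDl.
  exists (fine (\sum_(0 <= k <oo) (u k)%:E)%E) => _ [n _ <-].
  rewrite -lee_fin fineK; last first.
    by rewrite ge0_fin_numE // nneseries_ge0 // => k _ _; rewrite lee_fin.
  rewrite /series /= -sumEFin; apply: nneseries_lim_ge => k _.
  by rewrite lee_fin.
split=> //; rewrite -EFin_lim //; congr (limn _).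
by apply/funext => n; rewrite /= /series /= sumEFin.
Qed.

Lemma cvg_sqnormc x : cvgn (series (fun k => sqnormc (x k))).
Proof.
apply: (eseries_fin_cvg _ _).1 => [k|]; first exact: sqnormc_ge0.
by have := ell2_valP x; rewrite inE.
Qed.

Definition rterm (x y : ell2 R) (k : nat) : R :=
  complex.Re (x k) * complex.Re (y k) + complex.Im (x k) * complex.Im (y k).

Lemma rinnerE x y : rinner x y = limn (series (rterm x y)).
Proof.
rewrite /rinner /=; congr (limn (series _)); apply/funext => k.
by rewrite /rterm; case: (x k) (y k) => [a b] [c d] /=; rewrite mulrN opprK.
Qed.

(** Absolute convergence: $|ac+bd|\le(a^2+b^2)+(c^2+d^2)$ dominates the terms by two summable
    series. *)
Lemma cvg_rterm x y : cvgn (series (rterm x y)).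
Proof.
apply: normed_cvg.
apply: (@series_le_cvg _ _ (fun k => sqnormc (x k) + sqnormc (y k))).
- by move=> k; rewrite normr_ge0.
- by move=> k; rewrite addr_ge0 ?sqnormc_ge0.
- move=> k /=; rewrite /rterm /sqnormc; case: (x k) (y k) => [a b] [c d] /=.
  have := (sqr_ge0 (a + c), sqr_ge0 (b + d), sqr_ge0 (a - c), sqr_ge0 (b - d)).
  have := (sqr_ge0 a, sqr_ge0 b, sqr_ge0 c, sqr_ge0 d).
  by move=> [[[? ?] ?] ?] [[[? ?] ?] ?]; rewrite ler_norml;
    apply/andP; split; lra.
- have -> : series (fun k => sqnormc (x k) + sqnormc (y k)) =
     series (fun k => sqnormc (x k)) + series (fun k => sqnormc (y k)).
    by apply/funext => n; rewrite /series /= big_split.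
  by apply: is_cvgD; exact: cvg_sqnormc.
Qed.

Lemma rinnerDl x y z : rinner (x + y) z = rinner x z + rinner y z.
Proof.
rewrite !rinnerE -limD; [|exact: cvg_rterm..]; congr (limn _).
apply/funext => n; rewrite fctE /series /= -big_split /=; apply: eq_bigr => k _.
rewrite /rterm ell2D.
by case: (x k) (y k) (z k) => [a b] [c d] [e f] /=; ring.
Qed.

Lemma rinnerC x y : rinner x y = rinner y x.
Proof.
rewrite !rinnerE; congr (limn (series _)); apply/funext => k.
by rewrite /rterm mulrC [X in _ + X]mulrC.
Qed.

Lemma rinnerZl c x y : rinner (c%:C *: x) y = c * rinner x y.
Proof.
rewrite !rinnerE -[RHS]limZl_tmp; last exact: cvg_rterm.
congr (limn _); apply/funext => n.
rewrite fctE /series /= scaler_sumr; apply: eq_bigr => k _.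
rewrite /rterm ell2Z /GRing.scale /=.
by case: (x k) (y k) => [a b] [d e] /=; ring.
Qed.

Lemma rinner_iZ x y : rinner ('i *: x) y = - rinner x ('i *: y).
Proof.
rewrite !rinnerE -limN; last exact: cvg_rterm.
congr (limn _); apply/funext => n.
rewrite fctE /series /= -sumrN; apply: eq_bigr => k _.
rewrite /rterm !ell2Z.
by case: (x k) (y k) => [a b] [d e] /=; ring.
Qed.

(** Termwise, $\overline{iy}=-i\bar y$ and $\mathrm{Re}(-iw)=\mathrm{Im}\,w$. *)
Lemma innerE x y : inner x y = rinner x y +i* rinner x ('i *: y).
Proof.
rewrite (rinnerE x ('i *: y)) /rinner /inner /=; congr (_ +i* limn (series _)).
apply/funext => k; rewrite /rterm ell2Z.
by case: (x k) (y k) => [a b] [d e] /=; ring.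
Qed.

Lemma sqnormc_rterm x k : rterm x x k = sqnormc (x k).
Proof. by rewrite /rterm /sqnormc !expr2. Qed.

Lemma sqnormc_le_rinner x k : sqnormc (x k) <= rinner x x.
Proof.
rewrite rinnerE.
have nd : nondecreasing_seq (series (rterm x x)).
  apply/nondecreasing_seqP => n; rewrite /series /= big_nat_recr //= lerDl.
  by rewrite sqnormc_rterm sqnormc_ge0.
apply: le_trans (nondecreasing_cvgn_le nd (@cvg_rterm x x) k.+1).
rewrite /series /= big_nat_recr //= sqnormc_rterm lerDr sumr_ge0 // => i _.
by rewrite sqnormc_rterm sqnormc_ge0.
Qed.

Lemma rinner_ge0 x : 0 <= rinner x x.
Proof. exact: le_trans (sqnormc_ge0 (x 0)) (sqnormc_le_rinner x 0). Qed.

Lemma rinner_eq0 x : rinner x x = 0 -> x = 0.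
Proof.
move=> x0; apply: ell2P => k.
have := sqnormc_le_rinner x k; rewrite x0 /sqnormc.
case: (x k) => [a b] /= ab.
have a0 : a ^+ 2 <= 0 by have := sqr_ge0 b; lra.
have b0 : b ^+ 2 <= 0 by have := sqr_ge0 a; lra.
have /eqP : a == 0 by rewrite -sqrf_eq0 eq_le a0 sqr_ge0.
have /eqP : b == 0 by rewrite -sqrf_eq0 eq_le b0 sqr_ge0.
by move=> -> ->.
Qed.

Lemma rinner_Zbasis x (l : R[i]) k : rinner x (l *: Defs.basis k) =
  complex.Re (x k) * complex.Re l + complex.Im (x k) * complex.Im l.
Proof.
set r := RHS.
have E : rterm x (l *: Defs.basis k) = fun i => if i == k then r else 0.
  apply/funext => i; rewrite /rterm ell2Z [Defs.basis k i]/=.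
  by case: eqP => [->|_]; rewrite ?mulr1 // !mulr0 addr0.
rewrite rinnerE E; apply/cvg_lim => //; apply: cvg_near_cst.
(* [series] at [n] sums the indices below [n], so it is constant from [k.+1] on. *)
exists k.+1 => // n /= kn.
rewrite /series /= (bigD1_seq k) ?mem_index_iota ?iota_uniq //=.
by rewrite eqxx big1 ?addr0 // => i /negPf ->.
Qed.

Lemma rinnerDr x y z : rinner z (x + y) = rinner z x + rinner z y.
Proof. by rewrite rinnerC rinnerDl !(rinnerC z). Qed.

Lemma rinnerZr c x y : rinner y (c%:C *: x) = c * rinner y x.
Proof. by rewrite rinnerC rinnerZl (rinnerC y). Qed.

Lemma rinnerNl x y : rinner (- x) y = - rinner x y.
Proof. by rewrite -scaleN1r -[-1](rmorphN1 (real_complex R)) rinnerZl mulN1r. Qed.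

Lemma rinnerNr x y : rinner y (- x) = - rinner y x.
Proof. by rewrite rinnerC rinnerNl (rinnerC y). Qed.

Lemma norm2E x : norm2 x = Num.sqrt (rinner x x). Proof. by []. Qed.

Lemma norm2_ge0 x : 0 <= norm2 x. Proof. exact: sqrtr_ge0. Qed.

Lemma sqr_norm2 x : norm2 x ^+ 2 = rinner x x.
Proof. by rewrite sqr_sqrtr // rinner_ge0. Qed.

Lemma norm2_eq0 x : norm2 x = 0 -> x = 0.
Proof. by move=> x0; apply: rinner_eq0; rewrite -sqr_norm2 x0 expr0n. Qed.

Lemma rinner0l x : rinner 0 x = 0.
Proof.
by rewrite -(scale0r (0 : ell2 R)) -[0](rmorph0 (real_complex R)) rinnerZl mul0r.
Qed.

Lemma norm20 : norm2 (0 : ell2 R) = 0.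
Proof. by rewrite norm2E rinner0l sqrtr0. Qed.

Lemma cauchy_schwarz x y : `|rinner x y| <= norm2 x * norm2 y.
Proof.
have [/norm2_eq0 ->|y0] := eqVneq (norm2 y) 0.
  by rewrite norm20 mulr0 rinnerC rinner0l normr0.
rewrite -(@ler_pXn2r _ 2) ?nnegrE ?mulr_ge0 ?norm2_ge0 //.
rewrite -normrX ger0_norm ?sqr_ge0 // exprMn.
set s := norm2 y ^+ 2.
have s0 : 0 < s by rewrite exprn_gt0 // lt_neqAle eq_sym y0 norm2_ge0.
(* This vector is $|y|^2$ times the component of $x$ orthogonal to $y$; the scaling avoids a
   division. *)
have := rinner_ge0 (s%:C *: x + (- rinner x y)%:C *: y).
rewrite !(rinnerDl, rinnerDr, rinnerZl, rinnerZr) -!sqr_norm2 -/s.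
rewrite (rinnerC y x) => h.
have : 0 <= s * (norm2 x ^+ 2 * s - rinner x y ^+ 2) by apply: le_trans h _; lra.
by rewrite pmulr_rge0 // subr_ge0.
Qed.

Lemma norm2D x y : norm2 (x + y) <= norm2 x + norm2 y.
Proof.
rewrite -(@ler_pXn2r _ 2) ?nnegrE ?addr_ge0 ?norm2_ge0 //.
rewrite sqr_norm2 !(rinnerDl, rinnerDr) -!sqr_norm2 (rinnerC y x).
by have := ler_normlW (cauchy_schwarz x y); lra.
Qed.

Lemma norm2Z c x : norm2 (c%:C *: x) = `|c| * norm2 x.
Proof.
by rewrite norm2E rinnerZl rinnerZr mulrA -expr2 sqrtrM ?sqr_ge0 // sqrtr_sqr.
Qed.

Lemma norm2N x : norm2 (- x) = norm2 x.
Proof. by rewrite norm2E rinnerNl rinnerNr opprK. Qed.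

Lemma norm2B x y z : norm2 (x - z) <= norm2 (x - y) + norm2 (y - z).
Proof. by rewrite -[x - z](subrKA y) norm2D. Qed.

End InnerProduct.

(** * Bounded operators and the operator norm *)

Section BoundedOperators.
Context {R : realType}.
Implicit Types (x y z v w : ell2 R) (a b : op R) (c e : R).

Lemma linear_opD a x y : linear a -> a (x + y) = a x + a y.
Proof. by move=> la; rewrite -[x in LHS]scale1r la scale1r. Qed.

Lemma linear_op0 a : linear a -> a 0 = 0.
Proof. by move=> la; apply: (addrI (a 0)); rewrite -linear_opD // !addr0. Qed.

Lemma linear_opZ a (l : R[i]) x : linear a -> a (l *: x) = l *: a x.
Proof. by move=> la; rewrite -[l *: x]addr0 la linear_op0 // addr0. Qed.

Lemma linear_opB a x y : linear a -> a (x - y) = a x - a y.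
Proof. by move=> la; rewrite -scaleN1r linear_opD // linear_opZ // scaleN1r. Qed.

Lemma opnorm_ge0 a : 0 <= opnorm a.
Proof.
rewrite /opnorm; set A := (X in sup X).
(* Without a supremum, [sup] takes its default value 0. *)
have [sA|] := pselect (has_sup A); last by move=> nA; rewrite sup_out.
apply: le_trans (norm2_ge0 (a 0)) _; apply: sup_upper_bound => //.
by exists 0 => //=; rewrite norm20 ler01.
Qed.

Lemma opnorm_le a c : 0 <= c -> (forall v, norm2 (a v) <= c * norm2 v) ->
  opnorm a <= c.
Proof.
move=> c0 ac; apply: ge_sup.
  by exists (norm2 (a 0)); exists 0 => //=; rewrite norm20 ler01.
move=> _ [v /= v1 <-]; apply: le_trans (ac v) _.
by rewrite -[leRHS]mulr1 ler_wpM2l.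
Qed.

Lemma le_opnorm a v : bounded_op a -> norm2 (a v) <= opnorm a * norm2 v.
Proof.
move=> [la [M aM]].
have [/norm2_eq0 ->|v0] := eqVneq (norm2 v) 0.
  by rewrite linear_op0 // norm20 mulr0.
have nv : 0 < norm2 v by rewrite lt_neqAle eq_sym v0 norm2_ge0.
set u := (norm2 v)^-1%:C *: v.
have u1 : norm2 u = 1 by rewrite norm2Z ger0_norm ?invr_ge0 ?norm2_ge0 // mulVf.
suff : norm2 (a u) <= opnorm a.
  rewrite linear_opZ // norm2Z ger0_norm ?invr_ge0 ?norm2_ge0 //.
  by rewrite mulrC ler_pdivrMr.
apply: ub_le_sup; last by exists u => //=; rewrite u1.
(* The sign of [M] is not given, hence the absolute value. *)
exists `|M| => _ [w /= w1 <-].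
apply: le_trans (aM w) _; apply: le_trans (ler_norm _) _.
rewrite normrM -[leRHS]mulr1 ler_wpM2l //.
by rewrite ger0_norm ?norm2_ge0.
Qed.

Lemma bounded_op_comp a b : bounded_op a -> bounded_op b -> bounded_op (a \o b).
Proof.
move=> ba bb; split=> [l x y /=|]; first by rewrite bb.1 ba.1.
exists (opnorm a * opnorm b) => v /=; apply: le_trans (le_opnorm _ ba) _.
by rewrite -mulrA ler_wpM2l ?opnorm_ge0 // le_opnorm.
Qed.

Lemma bounded_opB a b : bounded_op a -> bounded_op b -> bounded_op (a - b).
Proof.
move=> ba bb; split=> [l x y /=|].
  by rewrite !fctE bb.1 ba.1 scalerBr addrACA opprD.
exists (opnorm a + opnorm b) => v; rewrite fctE mulrDl.
apply: le_trans (norm2D _ _) _.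
by rewrite norm2N lerD // le_opnorm.
Qed.

Lemma opnormB_le a b c v : bounded_op a -> bounded_op b -> opnorm (a - b) <= c ->
  norm2 (a v - b v) <= c * norm2 v.
Proof.
move=> ba bb abc; apply: le_trans (le_opnorm v (bounded_opB ba bb)) _.
by rewrite ler_wpM2r ?norm2_ge0.
Qed.

End BoundedOperators.

(** * Polynomials in an operator *)

Section PolynomialCalculus.
Context {R : realType}.
Implicit Types (x y z v w : ell2 R) (a b : op R) (c e : R) (p q : {poly R}).

(** Padding with zero coefficients puts polynomials of different sizes over one index range. *)
Lemma poly_op_widen n p a v : (size p <= n)%N ->
  poly_op p a v = \sum_(i < n) (p`_i)%:C *: iter i a v.
Proof.
move=> pn; rewrite /poly_op (big_ord_widen n (fun i => (p`_i)%:C *: iter i a v)) //.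
rewrite big_mkcond; apply: eq_bigr => i _; case: ifPn => //.
by rewrite -leqNgt => /(nth_default 0) ->; rewrite rmorph0 scale0r.
Qed.

Lemma poly_opD p q a v : poly_op (p + q) a v = poly_op p a v + poly_op q a v.
Proof.
pose n := maxn (size p) (size q).
rewrite !(@poly_op_widen n) ?leq_maxl ?leq_maxr ?size_polyD // -big_split.
by apply: eq_bigr => i _; rewrite /= coefD rmorphD scalerDl.
Qed.

Lemma poly_opZ c p a v : poly_op (c *: p) a v = c%:C *: poly_op p a v.
Proof.
rewrite (@poly_op_widen (size p)) ?size_scale_leq // scaler_sumr.
by apply: eq_bigr => i _; rewrite coefZ rmorphM scalerA.
Qed.

Lemma poly_opC c a v : poly_op c%:P a v = c%:C *: v.
Proof. by rewrite (@poly_op_widen 1) ?size_polyC_leq1 // big_ord1 coefC eqxx. Qed.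

Lemma poly_op0 a v : poly_op 0 a v = 0.
Proof. by rewrite -[0]polyC0 poly_opC scale0r. Qed.

(** The Horner step: with [poly_opD] and [poly_opC] it drives the inductions by [poly_ind]. *)
Lemma poly_opMX p a v : poly_op (p * 'X) a v = poly_op p a (a v).
Proof.
rewrite (@poly_op_widen (size p).+1); last first.
  by rewrite (leq_trans (size_polyMleq _ _)) // size_polyX addn2.
rewrite big_ord_recl coefMX eqxx rmorph0 scale0r add0r.
by apply: eq_bigr => i _; rewrite coefMX /= -iterSr.
Qed.

Lemma poly_opX a v : poly_op 'X a v = a v.
Proof. by rewrite -['X]mul1r poly_opMX -[1]polyC1 poly_opC scale1r. Qed.

Lemma poly_opN p a v : poly_op (- p) a v = - poly_op p a v.
Proof. by rewrite -scaleN1r poly_opZ rmorphN1 scaleN1r. Qed.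

Lemma poly_opB p q a v : poly_op (p - q) a v = poly_op p a v - poly_op q a v.
Proof. by rewrite poly_opD poly_opN. Qed.

Lemma bounded_poly_op p a : bounded_op a -> bounded_op (poly_op p a).
Proof.
move=> ba; elim/poly_ind: p => [|p c [lp [M pM]]].
  split=> [l x y|]; first by rewrite !poly_op0 scaler0 addr0.
  by exists 0 => v; rewrite poly_op0 norm20 mul0r.
have E v : poly_op (p * 'X + c%:P) a v = poly_op p a (a v) + c%:C *: v.
  by rewrite poly_opD poly_opMX poly_opC.
split=> [l x y|].
  rewrite !E ba.1 lp !scalerDr addrACA; congr (_ + (_ + _)).
  by rewrite !scalerA mulrC.
exists (`|M| * opnorm a + `|c|) => v; rewrite E mulrDl.
apply: le_trans (norm2D _ _) _; rewrite norm2Z lerD //.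
apply: le_trans (pM _) _; apply: le_trans (ler_norm _) _.
rewrite normrM (ger0_norm (norm2_ge0 _)) -mulrA ler_wpM2l //.
exact: le_opnorm.
Qed.

Lemma poly_op_comm p a v : linear a -> poly_op p a (a v) = a (poly_op p a v).
Proof.
move=> la; elim/poly_ind: p v => [|p c IH] v.
  by rewrite !poly_op0 linear_op0.
by rewrite !poly_opD !poly_opMX !poly_opC IH (linear_opD _ _ la) (linear_opZ _ _ la).
Qed.

Lemma poly_opM p q a v : bounded_op a ->
  poly_op (p * q) a v = poly_op p a (poly_op q a v).
Proof.
move=> ba; elim/poly_ind: p v => [|p c IH] v; first by rewrite mul0r !poly_op0.
rewrite mulrDl mulrAC !poly_opD !poly_opMX IH poly_op_comm; last exact: ba.1.
by rewrite mul_polyC poly_opZ poly_opC.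
Qed.

Lemma poly_op_compX2 p a v : bounded_op a ->
  poly_op p (a \o a) v = poly_op (p \Po 'X^2) a v.
Proof.
move=> ba; elim/poly_ind: p v => [|p c IH] v.
  by rewrite comp_poly0 !poly_op0.
rewrite comp_polyD comp_polyM comp_polyX comp_polyC !poly_opD poly_opMX !poly_opC.
by rewrite IH expr2 mulrA !poly_opMX.
Qed.

End PolynomialCalculus.

(** * Positive operators and real polynomials in them *)

Section PositiveOperators.
Context {R : realType}.
Implicit Types (x y z v w : ell2 R) (a b : op R) (c e : R) (p q s : {poly R}).

(** For a complex linear [a], real parts suffice: multiplying a vector by ['i] yields the imaginary
    parts. *)
Definition symmetric_op a := forall v w, rinner (a v) w = rinner v (a w).

Lemma positive_op_rinner a v : positive_op a ->
  0 <= rinner (a v) v /\ rinner (a v) ('i *: v) = 0.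
Proof. by move=> [_ /(_ v)]; rewrite innerE lecE /= => /andP[/eqP-> ->]. Qed.

(** Polarisation: $\mathrm{Im}\langle av,v\rangle$ vanishes for all $v$, and expanding it at $v+w$
    gives [polar]. Replacing $w$ by $iw$ there yields the symmetry. *)
Lemma positive_op_symmetric a : positive_op a -> symmetric_op a.
Proof.
move=> pa; have la : linear a by case: pa => -[].
have im0 v : rinner (a v) ('i *: v) = 0 by have [] := positive_op_rinner v pa.
have polar v w : rinner (a v) ('i *: w) = - rinner (a w) ('i *: v).
  have := im0 (v + w); rewrite (linear_opD _ _ la) scalerDr !(rinnerDl, rinnerDr).
  by rewrite !im0 add0r addr0 => /eqP; rewrite addr_eq0 => /eqP.
have sqi w : 'i *: ('i *: w) = - w by rewrite scalerA -expr2 sqr_i scaleN1r.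
move=> v w; apply: oppr_inj; rewrite -rinnerNr -sqi polar (linear_opZ _ _ la).
by rewrite rinner_iZ opprK sqi rinnerNr rinnerC.
Qed.

(** [adjoint] chooses some map with the adjoint property; [a] has this property, and any two such
    maps agree because their difference at [w] is orthogonal to every vector. *)
Lemma positive_op_selfadjoint a : positive_op a -> adjoint a = a.
Proof.
move=> pa; have la : linear a by case: pa => -[].
have sa := positive_op_symmetric pa.
have ia v w : inner (a v) w = inner v (a w).
  rewrite !innerE sa; congr (_ +i* _).
  by rewrite -[LHS]opprK -rinner_iZ -(linear_opZ _ _ la) sa rinner_iZ opprK.
have aa : exists b : op R, forall v w, inner (a v) w = inner v (b w) by exists a.
have ad := xgetPex (fun=> 0 : ell2 R) aa.
apply/funext => w; apply/eqP; rewrite -subr_eq0; apply/eqP/rinner_eq0.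
rewrite rinnerDr rinnerNr /rinner -[adjoint a]/(xget _ _).
by rewrite -ad ia subrr.
Qed.

Lemma poly_op_symmetric p a : bounded_op a -> symmetric_op a ->
  symmetric_op (poly_op p a).
Proof.
move=> ba sa; elim/poly_ind: p => [|p c IH] v w.
  by rewrite !poly_op0 rinner0l rinnerC rinner0l.
rewrite !(poly_opD, poly_opMX, poly_opC, rinnerDl, rinnerDr, rinnerZl, rinnerZr).
by rewrite IH sa poly_op_comm //; case: ba.
Qed.

Lemma rinner_sub_ge0 a v : bounded_op a ->
  0 <= opnorm a * rinner v v - rinner (a v) v.
Proof.
move=> ba; rewrite subr_ge0; apply: le_trans (ler_norm _) _.
apply: le_trans (cauchy_schwarz _ _) _; rewrite -sqr_norm2 expr2 mulrA.
by rewrite ler_wpM2r ?norm2_ge0 // le_opnorm.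
Qed.

(** Take a complex root $r+ib$. If $b\ne0$, the remainder modulo $(X-r)^2+b^2$ has degree at most
    one, real coefficients and the nonreal root $r+ib$, so it is zero. *)
Lemma real_poly_factor p : (1 < size p)%N ->
  (exists r : R, root p r) \/
  (exists r c : R, c != 0 /\ ('X - r%:P) ^+ 2 + (c ^+ 2)%:P %| p).
Proof.
move=> p1; pose p' : {poly R[i]} := map_poly (real_complex R) p.
have /closed_rootP[[r b]] : size p' != 1 by rewrite size_map_poly neq_ltn p1 orbT.
rewrite /root => /eqP rz.
have [b0|b0] := eqVneq b 0.
  left; exists r; rewrite b0 in rz.
  by rewrite /root -(inj_eq (@complexI R)) -horner_map; apply/eqP.
right; exists r, b; split=> //; set d := _ + _.
have dz : (map_poly (real_complex R) d).[r +i* b] = 0.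
  rewrite /d rmorphD rmorphXn rmorphB /= map_polyX !map_polyC /= !hornerE.
  by apply/eqP; rewrite eq_complex /=; apply/andP; split; apply/eqP; ring.
have sd : size d = 3%N.
  rewrite /d size_polyDl; first by rewrite size_exp_XsubC.
  by rewrite size_exp_XsubC (leq_ltn_trans (size_polyC_leq1 _)).
have d0 : d != 0 by rewrite -size_poly_gt0 sd.
have := divp_eq p d; set m := p %% d => pE.
have : (size m < 3)%N by rewrite -sd ltn_modp.
rewrite ltnS => m2.
have mE : m = (m`_0)%:P + m`_1 *: 'X.
  apply/polyP => -[|[|i]]; rewrite !coefE /= ?mulr0 ?mulr1 ?addr0 ?add0r //.
  by rewrite nth_default // (leq_trans m2).
have mz : (map_poly (real_complex R) m).[r +i* b] = 0.
  by move: rz; rewrite /p' pE rmorphD rmorphM /= !hornerE dz mulr0 add0r.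
move: mz; rewrite mE rmorphD /= map_polyC map_polyZ map_polyX /= !hornerE.
move/eqP; rewrite eq_complex /= => /andP[/eqP h1 /eqP h2].
have m1 : m`_1 = 0.
  by apply/eqP; rewrite -(mulIr_eq0 _ (mulIf b0)); apply/eqP; lra.
apply/modp_eq0P; rewrite -/m mE m1 scale0r addr0.
by move: h1; rewrite m1 => h1; rewrite (_ : m`_0 = 0) //; lra.
Qed.

(** * Polynomials that are positive on $[0,\|a\|]$ *)

Section Cone.
Variable a : op R.
Hypothesis pa : positive_op a.
Let M := opnorm a.
Let ba : bounded_op a := pa.1.
Let sa := positive_op_symmetric pa.

Definition poly_op_pos p := forall v, 0 <= rinner (poly_op p a v) v.

(** By symmetry of $s(a)$, $\langle s(a)^2p(a)v,v\rangle=\langle p(a)w,w\rangle$ with $w=s(a)v$. *)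
Lemma poly_op_posM2 s p : poly_op_pos p -> poly_op_pos (s ^+ 2 * p).
Proof.
move=> pp v; rewrite expr2 -mulrA (mulrC s p) !poly_opM //.
by rewrite (poly_op_symmetric s ba sa).
Qed.

Lemma poly_op_posD p q : poly_op_pos p -> poly_op_pos q -> poly_op_pos (p + q).
Proof. by move=> pp pq v; rewrite poly_opD rinnerDl addr_ge0. Qed.

Lemma poly_op_posZ c p : 0 <= c -> poly_op_pos p -> poly_op_pos (c *: p).
Proof. by move=> c0 pp v; rewrite poly_opZ rinnerZl mulr_ge0. Qed.

Let Y := M%:P - 'X : {poly R}.

Lemma poly_op_posX : poly_op_pos 'X.
Proof. by move=> v; rewrite poly_opX; have [] := positive_op_rinner v pa. Qed.

Lemma poly_op_posY : poly_op_pos Y.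
Proof.
move=> v; rewrite poly_opB poly_opC poly_opX rinnerDl rinnerNl rinnerZl.
exact: rinner_sub_ge0.
Qed.

(* [M X Y = X^2 Y + Y^2 X] when [Y = M - X]. *)
Lemma poly_op_posXY : poly_op_pos ('X * Y).
Proof.
have [M0|M0] := eqVneq M 0.
  have a0 v : a v = 0.
    apply: norm2_eq0; apply/le_anti; rewrite norm2_ge0 andbT.
    by have := le_opnorm v ba; rewrite -/M M0 mul0r.
  move=> v; rewrite mulrC poly_opMX a0.
  by rewrite (linear_op0 (bounded_poly_op _ ba).1) rinner0l.
have Mp : 0 < M by rewrite lt_neqAle eq_sym M0 opnorm_ge0.
have -> : 'X * Y = M^-1 *: ('X ^+ 2 * Y + Y ^+ 2 * 'X).
  rewrite -[LHS]scale1r -(mulVf M0) -scalerA; congr (_ *: _).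
  by rewrite -mul_polyC /Y; ring.
apply: poly_op_posZ; first by rewrite invr_ge0 ltW.
by apply: poly_op_posD; apply: poly_op_posM2;
  [exact: poly_op_posY|exact: poly_op_posX].
Qed.

(** Positivity of $p(a)$ alone is not visibly stable under multiplication by $X$ or $Y$. Carrying
    the four products along makes it so: a repeated factor becomes a square, which [poly_op_posM2]
    absorbs. *)
Definition poly_op_cone p := [/\ poly_op_pos p, poly_op_pos ('X * p),
  poly_op_pos (Y * p) & poly_op_pos ('X * Y * p)].

Lemma cone_const c : 0 <= c -> poly_op_cone c%:P.
Proof.
move=> c0; rewrite /poly_op_cone; split; last first.
- by rewrite mulrC mul_polyC; apply: poly_op_posZ => //; exact: poly_op_posXY.
- by rewrite mulrC mul_polyC; apply: poly_op_posZ => //; exact: poly_op_posY.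
- by rewrite mulrC mul_polyC; apply: poly_op_posZ => //; exact: poly_op_posX.
- by move=> v; rewrite poly_opC rinnerZl mulr_ge0 // rinner_ge0.
Qed.

Lemma coneD p q : poly_op_cone p -> poly_op_cone q -> poly_op_cone (p + q).
Proof.
by move=> [? ? ? ?] [? ? ? ?]; split; rewrite ?(mulrDr _ p q); apply: poly_op_posD.
Qed.

Lemma coneZ c p : 0 <= c -> poly_op_cone p -> poly_op_cone (c *: p).
Proof.
by move=> c0 [? ? ? ?]; split; rewrite -?scalerAr; apply: poly_op_posZ.
Qed.

Lemma coneM2 s p : poly_op_cone p -> poly_op_cone (s ^+ 2 * p).
Proof.
by move=> [? ? ? ?]; split; rewrite 1?mulrCA; apply: poly_op_posM2.
Qed.

Lemma coneMX p : poly_op_cone p -> poly_op_cone ('X * p).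
Proof.
move=> [p1 pX pY pXY]; split=> //.
- by rewrite mulrA -expr2; apply: poly_op_posM2.
- by rewrite mulrCA mulrA.
- rewrite (_ : 'X * Y * ('X * p) = 'X ^+ 2 * (Y * p)); last by ring.
  exact: poly_op_posM2.
Qed.

Lemma coneMY p : poly_op_cone p -> poly_op_cone (Y * p).
Proof.
move=> [p1 pX pY pXY]; split=> //.
- by rewrite mulrA.
- by rewrite mulrA -expr2; apply: poly_op_posM2.
- rewrite (_ : 'X * Y * (Y * p) = Y ^+ 2 * ('X * p)); last by ring.
  exact: poly_op_posM2.
Qed.

(** Induction on the degree. A root $r<0$ gives the factor $X+(-r)$, a root $r>M$ gives
    $r-X=Y+(r-M)$, and a conjugate pair gives a square plus a positive constant; each such factor
    preserves the cone. *)
Lemma cone_gt0 p : (forall t, 0 <= t <= M -> 0 < p.[t]) -> poly_op_cone p.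
Proof.
have M0 : 0 <= M := opnorm_ge0 a.
have [n] := ubnP (size p); elim: n p => // n IH p /[!ltnS] pn p0.
have [p1|p1] := leqP (size p) 1.
  rewrite (size1_polyC p1); apply: cone_const.
  have := p0 0; rewrite lexx M0 (size1_polyC p1) hornerC.
  by move=> /(_ isT)/ltW; rewrite coefC.
have p_neq0 : p != 0 by rewrite -size_poly_gt0 (ltn_trans _ p1).
have [[r rp]|[r [b [b0 dp]]]] := real_poly_factor p1.
- have /factor_theorem[q pE] := rp.
  have q_neq0 : q != 0 by apply: contraNneq p_neq0 => q0; rewrite pE q0 mul0r.
  have qn : (size q < n)%N.
    move: pn; rewrite pE size_Mmonic ?monicXsubC // size_XsubC addn2 /=; exact.
  have [r0|r0] := ltP r 0.
    have cq : poly_op_cone q.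
      apply: IH => // t tM; have := p0 t tM; rewrite pE !hornerE pmulr_lgt0 //.
      by case/andP: tM => t0 _; lra.
    rewrite pE mulrC mulrBl; apply: coneD; first exact: coneMX.
    by rewrite -mulNr -polyCN mul_polyC; apply: coneZ => //; rewrite oppr_ge0 ltW.
  (* A root in $[0,M]$ contradicts the strict positivity of [p] there. *)
  have [rM|rM] := ltP M r; last first.
    by have := p0 r; rewrite r0 rM (rootP rp) ltxx => /(_ isT).
  (* On $[0,M]$ the factor $X-r$ is negative, so the induction hypothesis applies to [- q]. *)
  have cq : poly_op_cone (- q).
    apply: IH; first by rewrite size_polyN.
    move=> t tM; have := p0 t tM; rewrite pE !hornerE => h.
    have rt : 0 < r - t by case/andP: tM => _ t0; lra.
    rewrite -(pmulr_rgt0 _ rt); apply: lt_le_trans h _; rewrite le_eqVlt; apply/orP; left.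
    by apply/eqP; ring.
  have -> : p = Y * (- q) + (r - M) *: (- q).
    by rewrite pE /Y -mul_polyC polyCB; ring.
  apply: coneD; first exact: coneMY.
  by apply: coneZ => //; rewrite subr_ge0 ltW.
- set d := (X in X %| p) in dp.
  have := divpK dp; set q := p %/ d => pE.
  have sd : size d = 3%N.
    rewrite /d size_polyDl; first by rewrite size_exp_XsubC.
    by rewrite size_exp_XsubC (leq_ltn_trans (size_polyC_leq1 _)).
  have d_neq0 : d != 0 by rewrite -size_poly_gt0 sd.
  have qn : (size q < n)%N.
    by apply: leq_trans pn; rewrite /q size_divp // sd ltn_subrL size_poly_gt0 p_neq0.
  have cq : poly_op_cone q.
    apply: IH => // t tM; have := p0 t tM; rewrite -pE hornerM pmulr_lgt0 //.
    rewrite /d !hornerE ltr_wpDl ?sqr_ge0 // lt_neqAle sqr_ge0 andbT eq_sym.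
    by rewrite sqrf_eq0.
  rewrite -pE mulrC /d mulrDl; apply: coneD; first exact: coneM2.
  by rewrite mul_polyC; apply: coneZ => //; exact: sqr_ge0.
Qed.

(** For $e>0$ the polynomial $(c+e)^2-p^2$ is strictly positive on $[0,M]$, so [cone_gt0] gives
    $|p(a)v|^2\le(c+e)^2|v|^2$; then $e\to0$. *)
Lemma norm2_poly_op_le p c v : 0 <= c ->
  (forall t, 0 <= t <= M -> `|p.[t]| <= c) ->
  norm2 (poly_op p a v) <= c * norm2 v.
Proof.
move=> c0 pc.
have pe e : 0 < e -> norm2 (poly_op p a v) <= (c + e) * norm2 v.
  move=> e0.
  have [h _ _ _] : poly_op_cone (((c + e) ^+ 2)%:P - p ^+ 2).
    apply: cone_gt0 => t tM; rewrite !hornerE subr_gt0 -[ltLHS]real_normK ?num_real //.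
    rewrite ltr_pXn2r ?nnegrE //; last by rewrite addr_ge0 // ltW.
    by rewrite (le_lt_trans (pc t tM)) // ltrDl.
  have ce : 0 <= c + e by rewrite addr_ge0 // ltW.
  rewrite -(@ler_pXn2r _ 2) ?nnegrE ?mulr_ge0 ?norm2_ge0 // exprMn !sqr_norm2.
  have := h v; rewrite poly_opB poly_opC expr2 poly_opM // rinnerDl rinnerNl.
  by rewrite rinnerZl (poly_op_symmetric p ba sa (poly_op p a v)) subr_ge0.
apply/ler_addgt0Pr => e e0.
(* Adding 1 keeps the denominator nonzero when [v] is 0. *)
have n0 : 0 < norm2 v + 1 by rewrite ltr_wpDl ?norm2_ge0.
apply: le_trans (pe (e / (norm2 v + 1)) _) _; first by rewrite divr_gt0.
by rewrite mulrDl lerD2l mulrAC ler_pdivrMr // ler_pM2l // lerDl ler01.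
Qed.

End Cone.
End PositiveOperators.

(** * Functional calculus and powers of $a^2$ *)

Section FunctionalCalculus.
Context {R : realType}.
Implicit Types (x y z v w : ell2 R) (a b : op R) (c e : R) (p q : {poly R}).

(** The bound [e <= 1] lets second-order errors be absorbed into a multiple of [e]. *)
Lemma le_of_small_error (x y k : R) : 0 <= k ->
  (forall e, 0 < e -> e <= 1 -> x <= y + e * k) -> x <= y.
Proof.
move=> k0 h; apply/ler_addgt0Pr => e e0.
have k1 : 0 < k + 1 by rewrite ltr_wpDl.
pose d := Num.min 1 (e / (k + 1)).
have d0 : 0 < d by rewrite lt_min ltr01 divr_gt0.
apply: le_trans (h d d0 _) _; first by rewrite ge_min lexx.
rewrite lerD2l; apply: (@le_trans _ _ (e / (k + 1) * k)).
  by rewrite ler_wpM2r // ge_min lexx orbT.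
by rewrite mulrAC ler_pdivrMr // ler_pM2l // lerDl ler01.
Qed.

Section ApproximationBySquares.
Variables (a b : op R) (f : R -> R) (K : R).
Hypothesis pa : positive_op a.
Hypothesis fab : is_fcalc f a b.
Hypothesis fK : forall t, 0 <= t <= opnorm a -> `|f t| <= K.
Let M := opnorm a.

Lemma is_fcalc_approx e : 0 < e -> exists p,
  (forall t, 0 <= t <= M -> `|p.[t] - f t| <= e) /\
  (forall v, norm2 (poly_op p a v - b v) <= e * norm2 v).
Proof.
move=> e0; have [bb /(_ e e0)[p [pf pb]]] := fab.
exists p; split=> // v; apply: opnormB_le => //.
by apply: bounded_poly_op; case: pa.
Qed.

(** Symmetry passes from the operators $p(a)$ to their norm limit $b$. *)
Lemma is_fcalc_symmetric : symmetric_op b.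
Proof.
move=> v w; apply/eqP; rewrite -subr_eq0 -normr_le0.
apply: (@le_of_small_error _ _ (2 * (norm2 v * norm2 w))).
  by rewrite !mulr_ge0 ?norm2_ge0.
move=> e e0 _; have [p [_ pb]] := is_fcalc_approx e0; rewrite add0r.
have -> : rinner (b v) w - rinner v (b w) =
    rinner v (poly_op p a w - b w) - rinner (poly_op p a v - b v) w.
  rewrite !(rinnerDl, rinnerDr, rinnerNl, rinnerNr).
  by rewrite (poly_op_symmetric p pa.1 (positive_op_symmetric pa)); ring.
apply: le_trans (ler_normB _ _) _.
have h1 := cauchy_schwarz v (poly_op p a w - b w).
have h2 := cauchy_schwarz (poly_op p a v - b v) w.
have h3 := ler_wpM2l (norm2_ge0 v) (pb w).
have h4 := ler_wpM2r (norm2_ge0 w) (pb v).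
by lra.
Qed.

(** With $q$ close to $f$, go from $p(a)$ to $b^2$ through $q(a)^2$ and $q(a)b$. The first gap is a
    polynomial in $a$, bounded by its supremum on $[0,M]$; the other two come from $q(a)-b$. *)
Lemma poly_op_sub_square_le p c v : 0 <= c ->
  (forall t, 0 <= t <= M -> `|p.[t] - f t ^+ 2| <= c) ->
  norm2 (poly_op p a v - b (b v)) <= c * norm2 v.
Proof.
move=> c0 pf; have ba := pa.1; have bb := fab.1.
have K0 : 0 <= K.
  by apply: le_trans (fK (t := 0) _); rewrite ?normr_ge0 // lexx opnorm_ge0.
apply: (@le_of_small_error _ _ ((2 * K + 1 + (K + 1) + opnorm b) * norm2 v)).
  by rewrite mulr_ge0 ?norm2_ge0 ?addr_ge0 ?mulr_ge0 ?opnorm_ge0.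
move=> e e0 e1; have [q [qf qb]] := is_fcalc_approx e0.
have h1 : norm2 (poly_op p a v - poly_op q a (poly_op q a v))
    <= (c + e * (2 * K + 1)) * norm2 v.
  rewrite -poly_opM // -poly_opB; apply: norm2_poly_op_le => //.
    by rewrite addr_ge0 // mulr_ge0 ?addr_ge0 ?mulr_ge0 // ltW.
  move=> t tM; rewrite !hornerE.
  (* As $e\le1$, the last factor below is at most $2K+1$ in absolute value. *)
  have -> : p.[t] - q.[t] * q.[t] = (p.[t] - f t ^+ 2)
     - (q.[t] - f t) * (q.[t] - f t + 2 * f t) by ring.
  apply: le_trans (ler_normB _ _) _; apply: lerD; first exact: pf.
  rewrite normrM; apply: ler_pM => //; first exact: qf.
  apply: le_trans (ler_normD _ _) _; rewrite normrM normr_nat.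
  by have := qf t tM; have := fK tM; lra.
have h2 : norm2 (poly_op q a (poly_op q a v) - poly_op q a (b v))
    <= (K + 1) * (e * norm2 v).
  rewrite -(linear_opB _ _ (bounded_poly_op q ba).1).
  have qK : forall t, 0 <= t <= M -> `|q.[t]| <= K + 1.
    move=> t tM; have -> : q.[t] = f t + (q.[t] - f t) by ring.
    apply: le_trans (ler_normD _ _) _; apply: lerD; first exact: fK.
    exact: le_trans (qf t tM) e1.
  apply: le_trans (norm2_poly_op_le pa _ _ qK) _; first by rewrite addr_ge0.
  by rewrite ler_wpM2l ?addr_ge0.
have h3 : norm2 (poly_op q a (b v) - b (b v)) <= e * (opnorm b * norm2 v).
  by apply: le_trans (qb _) _; rewrite ler_wpM2l ?(ltW e0) // le_opnorm.
apply: le_trans (norm2B _ (poly_op q a (poly_op q a v)) _) _.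
apply: le_trans (lerD h1 (norm2B _ (poly_op q a (b v)) _)) _.
apply: le_trans (lerD (lexx _) (lerD h2 h3)) _.
by rewrite le_eqVlt; apply/orP; left; apply/eqP; ring.
Qed.

End ApproximationBySquares.

(** The lower bound comes from $|av|^2=\langle a^2v,v\rangle\le\|a^2\|\,|v|^2$. *)
Lemma opnorm_square a : positive_op a -> opnorm (a \o a) = opnorm a ^+ 2.
Proof.
move=> pa; have ba := pa.1; have baa := bounded_op_comp ba ba.
apply/le_anti/andP; split.
  apply: opnorm_le => [|v /=]; first exact: sqr_ge0.
  apply: le_trans (le_opnorm _ ba) _; rewrite expr2 -mulrA.
  by rewrite ler_wpM2l ?opnorm_ge0 // le_opnorm.
rewrite -[leRHS]sqr_sqrtr ?opnorm_ge0 // ler_pXn2r ?nnegrE ?sqrtr_ge0 ?opnorm_ge0 //.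
apply: opnorm_le => [|v]; first exact: sqrtr_ge0.
rewrite -(@ler_pXn2r _ 2) ?nnegrE ?mulr_ge0 ?sqrtr_ge0 ?norm2_ge0 //.
rewrite exprMn !sqr_norm2 sqr_sqrtr ?opnorm_ge0 //.
rewrite (positive_op_symmetric pa) rinnerC -subr_ge0.
exact: (rinner_sub_ge0 v baa).
Qed.

(* Rescaling the variable turns polynomials approximating [t `^ s] on
   [[0, |a|]] into ones on [[0, |a|^2]], which contains the spectrum of [a^2]. *)
Lemma is_fcalc_powR_square a b (s : R) : 0 < s -> positive_op a ->
  is_fcalc (fun t => t `^ s) a b ->
  is_fcalc (fun t => t `^ s) (a \o a) (b \o b) /\
  forall p e, 0 <= e ->
    (forall t, 0 <= t <= opnorm (a \o a) -> `|p.[t] - t `^ s| <= e) ->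
    forall v, norm2 (poly_op p (a \o a) v - b (b v)) <= e * norm2 v.
Proof.
move=> s0 pa fab; have ba := pa.1; have bb := fab.1; set M := opnorm a.
have M0 : 0 <= M := opnorm_ge0 a.
have fK t : 0 <= t <= M -> `|t `^ s| <= M `^ s.
  move=> /andP[t0 tM]; rewrite ger0_norm ?powR_ge0 //.
  by apply: ge0_ler_powR; rewrite ?nnegrE // ltW.
(* $p(a^2)$ is the polynomial $p(X^2)$ in $a$, and $(t^s)^2=(t^2)^s$. *)
have close p e : 0 <= e ->
    (forall t, 0 <= t <= opnorm (a \o a) -> `|p.[t] - t `^ s| <= e) ->
    forall v, norm2 (poly_op p (a \o a) v - b (b v)) <= e * norm2 v.
  move=> e0 pe v; rewrite poly_op_compX2 //.
  apply: (poly_op_sub_square_le pa fab fK) => // t /andP[t0 tM].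
  rewrite horner_comp hornerXn (_ : _ ^+ 2 = (t ^+ 2) `^ s); last first.
    by rewrite !expr2 powRM.
  apply: pe.
  by rewrite sqr_ge0 opnorm_square // ler_pXn2r ?nnegrE.
split=> //; split=> [|e e0]; first exact: bounded_op_comp.
have K0 : 0 < M `^ s + 1 by rewrite ltr_wpDl ?powR_ge0.
have [q [qf _]] := is_fcalc_approx pa fab (divr_gt0 e0 K0).
(* For $t\in[0,M^2]$ the point $t/M$ lies in $[0,M]$ and $t^s=M^s(t/M)^s$. The error of [q] gets
   multiplied by $M^s$, hence the tolerance $e/(M^s+1)$. If $M=0$, then $t=0$ and [M^-1] is 0. *)
exists (M `^ s *: (q \Po (M^-1 *: 'X))).
have pf t : 0 <= t <= opnorm (a \o a) ->
    `|(M `^ s *: (q \Po (M^-1 *: 'X))).[t] - t `^ s| <= e.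
  rewrite opnorm_square // -/M => /andP[t0 tM].
  have tE : t = M * (M^-1 * t).
    have [M_eq0|M_neq0] := eqVneq M 0; last by rewrite mulVKf.
    by apply/le_anti; rewrite M_eq0 mul0r t0 andbT; move: tM; rewrite M_eq0 expr0n.
  have u0 : 0 <= M^-1 * t by rewrite mulr_ge0 ?invr_ge0.
  have uM : M^-1 * t <= M.
    have [M_eq0|M_neq0] := eqVneq M 0; first by rewrite M_eq0 invr0 mul0r.
    have Mp : 0 < M by rewrite lt_neqAle eq_sym M_neq0.
    by rewrite mulrC ler_pdivrMr // -expr2.
  rewrite [in t `^ s]tE powRM // !hornerE horner_comp !hornerE -mulrBr normrM.
  rewrite ger0_norm ?powR_ge0 //; have := qf _ (introT andP (conj u0 uM)).
  move/(ler_wpM2l (powR_ge0 M s)) => h; apply: le_trans h _.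
  by rewrite mulrCA ler_piMr ?(ltW e0) // ler_pdivrMr // mul1r lerDl ler01.
split=> //; apply: opnorm_le; first exact: ltW.
by move=> v; rewrite !fctE; apply: close => //; exact: ltW.
Qed.

(** [op_pow] chooses some operator meeting [is_fcalc]. One exists, namely $b^2$, and the chosen one
    equals it, since a common $p(a^2)$ is close to both. *)
Lemma op_pow_square a b (s : R) : 0 < s -> positive_op a ->
  is_fcalc (fun t => t `^ s) a b -> op_pow (a \o a) s = b \o b.
Proof.
move=> s0 pa fab; have [ex close] := is_fcalc_powR_square s0 pa fab.
have fc : is_fcalc (fun t => t `^ s) (a \o a) (op_pow (a \o a) s).
  by apply: xgetPex; exists (b \o b).
apply/funext => v /=; apply/eqP; rewrite -subr_eq0; apply/eqP/norm2_eq0.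
apply/le_anti; rewrite norm2_ge0 andbT.
apply: (@le_of_small_error _ _ (2 * norm2 v)).
   by rewrite mulr_ge0 ?norm2_ge0.
move=> e e0 _; have [bo /(_ e e0)[p [pf pb]]] := fc.
apply: le_trans (norm2B _ (poly_op p (a \o a) v) _) _.
have h1 := close p e (ltW e0) pf v.
have h2 := opnormB_le v (bounded_poly_op p (bounded_op_comp pa.1 pa.1)) bo pb.
by rewrite -norm2N opprB in h2; lra.
Qed.

(** The default value of [xget] is the zero map, so a nonzero power is a genuine one. *)
Lemma op_pow_neq0 a (s : R) : op_pow a s <> (fun=> 0) ->
  is_fcalc (fun t => t `^ s) a (op_pow a s).
Proof.
rewrite /op_pow /fcalc; case: xgetP => [_ -> //|_] h.
by case: h.
Qed.

(** As $a$ is self-adjoint, $|a|^{2\theta}=(a^2)^\theta=(a^\theta)^2$, with diagonal entries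
    $|a^\theta e_k|^2$; the finite trace sums them. *)
Lemma Lp_pos_square_summable a (theta : R) : 0 < theta -> Lp_pos (2 * theta) a ->
  op_pow a theta <> (fun=> 0) ->
  symmetric_op (op_pow a theta) /\
  cvgn (series (fun k => norm2 (op_pow a theta (Defs.basis k)) ^+ 2)).
Proof.
move=> th0 [[_ tr] pa] /op_pow_neq0; set b := op_pow a theta => fab.
have sb := is_fcalc_symmetric pa fab; split=> //.
move: tr; rewrite /modulus_pow positive_op_selfadjoint // mulrAC divff ?pnatr_eq0 //.
rewrite mul1r (op_pow_square th0 pa fab) => tr.
apply: (eseries_fin_cvg _ _).1 => [k|]; first exact: sqr_ge0.
apply: le_lt_trans tr; rewrite /trace; apply: lee_nneseries => [k _ _|k _].
  by rewrite lee_fin sqr_ge0.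
by rewrite lee_fin sqr_norm2 -sb.
Qed.

End FunctionalCalculus.

(** * The operators $T_n$ and the contradiction *)

Section Counterexample.
Context {R : realType}.
Implicit Types (v w : ell2 R) (k : nat).

Lemma norm2_ge_ReIm v k :
  `|complex.Re (v k)| <= norm2 v /\ `|complex.Im (v k)| <= norm2 v.
Proof.
have := sqnormc_le_rinner v k; rewrite /sqnormc -sqr_norm2 => h.
have h1 := sqr_ge0 (complex.Re (v k)); have h2 := sqr_ge0 (complex.Im (v k)).
by split; rewrite -(@ler_pXn2r _ 2) ?nnegrE ?norm2_ge0 //;
  rewrite real_normK ?num_real //; lra.
Qed.

Let s k : R := (Num.sqrt k.+1%:R)^-1.

Let s_ge0 k : 0 <= s k. Proof. by rewrite invr_ge0 sqrtr_ge0. Qed.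

Let s2 k : s k ^+ 2 = k.+1%:R^-1.
Proof. by rewrite /s exprVn sqr_sqrtr. Qed.

(** With $n=k+1$, $T_n$ is the rank-one operator $v\mapsto\langle v,f_n\rangle f_n$, where
    $f_n=e_1+n^{-1/2}e_n$ is [Tvec k] and $\langle v,f_n\rangle$ is [Tform k v]. *)
Definition Tvec k : ell2 R := Defs.basis 0 + (s k)%:C *: Defs.basis k.

Definition Tform k v : R[i] := v 0 + (s k)%:C * v k.

Lemma TmapE k v : Tmap k v = Tform k v *: Tvec k.
Proof.
have e : (k.+1%:R^-1)%:C = (s k)%:C * (s k)%:C by rewrite -s2 expr2 rmorphM.
rewrite /Tmap /munit /Tform /Tvec -/(s k) e; move: (s k)%:C => c.
rewrite !scalerDr !scalerDl !scalerA -!addrA; congr (_ + _).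
rewrite (mulrC (v 0) c) (mulrAC c (v k) c) addrCA; congr (_ + _).
Qed.

Lemma rinner_ZTvec k v (l : R[i]) : rinner v (l *: Tvec k) =
  complex.Re (Tform k v) * complex.Re l + complex.Im (Tform k v) * complex.Im l.
Proof.
rewrite /Tvec scalerDr scalerA rinnerDr !rinner_Zbasis /Tform.
by case: (v 0) (v k) l => [a b] [c d] [e f] /=; ring.
Qed.

Lemma Tmap_positive k : positive_op (Tmap k : op R).
Proof.
have TC (c : R[i]) v w : Tform k (c *: v + w) = c * Tform k v + Tform k w.
  by rewrite /Tform !ell2D !ell2Z; ring.
split; last first.
  move=> v; rewrite TmapE innerE lecE /= -[rinner _ ('i *: v)]opprK -rinner_iZ.
  rewrite scalerA ![rinner (_ *: Tvec k) v]rinnerC !rinner_ZTvec.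
  case: (Tform k v) => [a b] /=; apply/andP; split.
    by apply/eqP; ring.
  by rewrite -!expr2 addr_ge0 ?sqr_ge0.
split=> [c v w|]; first by rewrite !TmapE TC scalerDl scalerA.
(* Each component of [Tform k v] is at most $(1+s_k)|v|$; they are split because [norm2Z] takes real
   scalars. *)
exists ((1 + s k) * (norm2 (Tvec k) + norm2 ('i *: Tvec k))) => v.
have -> : Tmap k v = (complex.Re (Tform k v))%:C *: Tvec k
    + (complex.Im (Tform k v))%:C *: ('i *: Tvec k).
  by rewrite TmapE scalerA (mulrC _ 'i) -scalerDl -complexE.
have [r0 i0] := norm2_ge_ReIm v 0; have [rk ik] := norm2_ge_ReIm v k.
have n0 := norm2_ge0 v.
have hr : `|complex.Re (Tform k v)| <= norm2 v * (1 + s k).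
  rewrite /Tform; case: (v 0) (v k) r0 rk => [a b] [c d] /= r0 rk.
  apply: le_trans (ler_normD _ _) _; rewrite mulrDr mulr1 lerD //.
  by rewrite mul0r subr0 normrM ger0_norm // mulrC ler_wpM2r.
have hi : `|complex.Im (Tform k v)| <= norm2 v * (1 + s k).
  rewrite /Tform; case: (v 0) (v k) i0 ik => [a b] [c d] /= i0 ik.
  apply: le_trans (ler_normD _ _) _; rewrite mulrDr mulr1 lerD //.
  by rewrite mul0r addr0 normrM ger0_norm // mulrC ler_wpM2r.
apply: le_trans (norm2D _ _) _; rewrite mulrC mulrA mulrDr lerD //.
  by rewrite norm2Z ler_wpM2r ?norm2_ge0.
by rewrite norm2Z ler_wpM2r ?norm2_ge0.
Qed.

(** Equality holds for [k > 0]; at [k = 0] the four matrix units coincide and the entry is 4. *)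
Lemma Tmap_basis0 k : s k <= rinner (Tmap k (Defs.basis 0)) (Defs.basis k).
Proof.
rewrite TmapE rinnerC rinner_ZTvec /Tform /=.
have s1 : s 0 = 1 by rewrite /s sqrtr1 invr1.
case: k => [|k] /=; first by rewrite s1; lra.
by rewrite eqxx !(mulr0, mulr1, subr0, addr0, add0r).
Qed.

Lemma not_asym_decomposition (theta : R) a b : 0 < theta ->
  ~ asym_decomposition (2 * theta) theta (fun k => Tmap k : op R) a b.
Proof.
move=> th0 [pa _ [u [uc T]]].
set A := op_pow a theta in T; set B := op_pow b (1 - theta) in T.
(* If [A] were zero, so would be $T_1$, whose first entry is positive. This rules out the default
   value of [op_pow]. *)
have A0 : A <> (fun=> 0).
  move=> A0; have := Tmap_basis0 0; rewrite T A0 /= rinner0l.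
  by rewrite /s sqrtr1 invr1 ler10.
have [sA cA] := Lp_pos_square_summable th0 pa A0.
pose c := norm2 (B (Defs.basis 0)).
have key k : k.+1%:R^-1 <= c ^+ 2 * norm2 (A (Defs.basis k)) ^+ 2.
  rewrite -s2 -exprMn ler_pXn2r ?nnegrE ?mulr_ge0 ?norm2_ge0 //.
  apply: le_trans (Tmap_basis0 k) _; rewrite T /= sA.
  apply: le_trans (ler_norm _) _; apply: le_trans (cauchy_schwarz _ _) _.
  rewrite ler_wpM2r ?norm2_ge0 //; have [bu u1] := uc k.
  apply: le_trans (le_opnorm _ bu) _.
  by rewrite -[leRHS]mul1r ler_wpM2r ?norm2_ge0.
(* By [key], a convergent series dominates the harmonic one. *)
apply: (@dvg_harmonic R).
apply: (@series_le_cvg _ _ (fun k => c ^+ 2 * norm2 (A (Defs.basis k)) ^+ 2)).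
- by move=> k; exact: harmonic_ge0.
- by move=> k; rewrite mulr_ge0 ?sqr_ge0.
- exact: key.
- have -> : series (fun k => c ^+ 2 * norm2 (A (Defs.basis k)) ^+ 2) =
    c ^+ 2 *: series (fun k => norm2 (A (Defs.basis k)) ^+ 2).
    by apply/funext => n; rewrite fctE /series /= scaler_sumr.
  exact: is_cvgZl_tmp.
Qed.

End Counterexample.

Theorem proposition3p14 (R : realType) :
  (forall k : nat, positive_op (Tmap k : op R)) /\
  (forall theta : R, 2^-1 < theta -> theta < 1 ->
     ~ strong_asym_type theta (2 * theta) (@Smap R)).
Proof.
(* At $z=1$ the sequence is $(T_n)$ itself, and its membership in [Lp_asym] supplies [a] and [b]. *)
split=> [k|theta th0 _ [C /(_ 1)[[a [b]]]]]; first exact: Tmap_positive.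
have -> : (fun n => Smap n 1) = (fun n => Tmap n : op R).
  by apply/funext => k; apply/funext => v; rewrite /Smap scale1r.
move=> dec _; apply: not_asym_decomposition dec.
by apply: lt_trans th0; rewrite invr_gt0.
Qed.
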